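(* Let $A$ be an S$^*$-base of a frame $L$. The following are equivalent. (1) $L$ is $A$-basic (that is, $A$, in its own order, is a $\sigma$-frame). (2) $A=D_\sigma A$. (3) The embedding $A\hookrightarrow L_\sigma$ has a left exact left adjoint. (4) There is a nucleus $\nu$ on $L_\sigma$ such that $A=\mathrm{fix}(\nu)$.
   Context: A subset $A$ of a frame $L$ is a base if every element of $L$ is a join of elements of $A$; it is an S-base if it is a base and a meet-semilattice whose binary meets agree with those of $L$; it is an S$^*$-base if moreover $A$ is bounded. A $\sigma$-frame is a bounded lattice with countable joins in which binary meets distribute over countable joins; a sub-$\sigma$-frame is a subset closed under finite meets and countable joins (including top and bottom). $L$ is $A$-basic if $A$ is a $\sigma$-frame in its own (induced) order; countable joins in $A$ need not agree with those in $L$. $L_\sigma$ is the sub-$\sigma$-frame of $L$ generated by $A$. A subset $G\subseteq A$ is admissible if $\bigvee G$ exists in $A$ and for each $a\in A$ the join $\bigvee\{a\wedge y: y\in G\}$ exists in $A$ and equals $a\wedge\bigvee G$. A downset $E$ of $A$ is a D-ideal if $\bigvee G\in E$ for each admissible $G\subseteq E$. $D_\infty A$ is the frame of D-ideals of $A$ under inclusion, and $A$ is identified with its image $\{{\downarrow}a:a\in A\}\subseteq D_\infty A$. $D_\sigma A$ is the sub-$\sigma$-frame of $D_\infty A$ generated by $A$. A left adjoint between meet-semilattices is left exact if it preserves binary meets. A nucleus on a $\sigma$-frame is an inflationary, idempotent self-map preserving binary meets; $\mathrm{fix}(\nu)$ is its set of fixpoints. *)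

(* Defs.v *)
From HB Require Import structures.
From mathcomp Require Import all_boot all_order.
From mathcomp Require Import boolp classical_sets cardinality.
Set Implicit Arguments.
Unset Strict Implicit.
Unset Printing Implicit Defensive.
Import Order.TTheory.
Local Open Scope classical_set_scope.
Local Open Scope order_scope.

(* [supremums G x] reads "x is the join of G": the joins below are taken in
   the poset that is the type of [x], never in an ambient one. *)

HB.mixin Record TBLattice_isFrame d L of Order.TBLattice d L := {
  bigjoin : set L -> L;
  bigjoinP : forall S : set L, supremums S (bigjoin S);
  meet_bigjoin : forall (a : L) (S : set L),
    a `&` bigjoin S = bigjoin [set a `&` s | s in S]
}.

#[short(type="frameType")]
HB.structure Definition Frame d :=
  { L of TBLattice_isFrame d L & Order.TBLattice d L }.

Record is_sigma_frame d (T : porderType d) : Prop := {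
  sframe_bot : exists b : T, forall x, b <= x;
  sframe_top : exists t : T, forall x, x <= t;
  sframe_meet : forall x y : T, exists m, infimums [set x; y] m;
  sframe_join : forall x y : T, exists j, supremums [set x; y] j;
  sframe_cjoin : forall G : set T, countable G -> exists s, supremums G s;
  sframe_distr : forall (a : T) (G : set T) (s m : T), countable G ->
    supremums G s -> infimums [set a; s] m ->
    supremums [set z | exists2 y, G y & infimums [set a; y] z] m
}.

Definition left_adjoint d d' (P : porderType d) (Q : porderType d')
    (f : P -> Q) (g : Q -> P) : Prop :=
  forall x y, (f x <= y) = (x <= g y).

Definition left_exact d d' (P : meetSemilatticeType d)
    (Q : meetSemilatticeType d') (f : P -> Q) : Prop :=
  {morph f : x y / x `&` y}.

Record is_nucleus d (P : meetSemilatticeType d) (nu : P -> P) : Prop := {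
  nucleus_le : forall x, x <= nu x;
  nucleus_idem : forall x, nu (nu x) = nu x;
  nucleus_meet : {morph nu : x y / x `&` y}
}.

Definition fix_set (T : Type) (nu : T -> T) : set T := [set x | nu x = x].

Definition meet_stable d (L : meetSemilatticeType d) (S : set L) : Prop :=
  forall x y, S x -> S y -> S (x `&` y).

(* [hS] is not used by the carrier: it is what the inferred meets need. *)
Definition sub_slat d (L : meetSemilatticeType d) (S : set L)
  (hS : meet_stable S) : Type := set_type S.

Section SubSemilattice.
Context d (L : meetSemilatticeType d) (S : set L) (hS : meet_stable S).

HB.instance Definition _ := SubChoice.copy (sub_slat hS) (set_type S).
HB.instance Definition _ :=
  [SubChoice_isSubPOrder of sub_slat hS by <: with d].

Lemma sub_slatP (x : sub_slat hS) : S (val x).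
Proof. exact: set_valP. Qed.

Definition mk_sub (x : L) (hx : S x) : sub_slat hS := exist _ x (mem_set hx).

Definition sub_meet (x y : sub_slat hS) : sub_slat hS :=
  mk_sub (hS (sub_slatP x) (sub_slatP y)).

Fact sub_lexI x y z : (x <= sub_meet y z) = (x <= y) && (x <= z).
Proof. by rewrite !leEsub /= lexI. Qed.

HB.instance Definition _ :=
  Order.POrder_isMeetSemilattice.Build d (sub_slat hS) sub_lexI.

End SubSemilattice.

Section Bases.
Context d (L : frameType d).
Implicit Types A S : set L.

Definition is_base A : Prop :=
  forall x, exists2 G, G `<=` A & x = bigjoin G.

Record is_S_base A : Prop := {
  S_base_base : is_base A;
  S_base_meet : meet_stable A
}.

(* The least element of [A] in its own order need not be the bottom of [L]. *)
Record is_Sstar_base A : Prop := {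
  Sstar_base_S_base :> is_S_base A;
  Sstar_base_bot : exists2 b, A b & forall a, A a -> b <= a;
  Sstar_base_top : exists2 t, A t & forall a, A a -> a <= t
}.

Record is_sub_sigma_frame S : Prop := {
  ssf_bot : S \bot;
  ssf_top : S \top;
  ssf_meet : meet_stable S;
  ssf_cjoin : forall G, countable G -> G `<=` S -> S (bigjoin G)
}.

Lemma sub_sigma_frameP (S : set L) (hS : is_sub_sigma_frame S) :
  is_sigma_frame (sub_slat (ssf_meet hS)).
Proof.
pose h := ssf_meet hS; pose P := sub_slat h.
pose bj (G : set P) : L := bigjoin [set val x | x in G].
have infP (x y m : P) : infimums [set x; y] m -> m = x `&` y.
  move=> [lb gl]; apply: le_anti.
  rewrite lexI (lb x) ?(lb y); [|by right|by left].
  by apply: gl => _ [->|->]; [exact: leIl|exact: leIr].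
have infI (x y : P) : infimums [set x; y] (x `&` y).
  split=> [_ [->|->]|z lb]; [exact: leIl|exact: leIr|].
  by rewrite lexI !lb //; [right|left].
have cj (G : set P) : countable G -> S (bj G).
  move=> cG; apply: (ssf_cjoin hS) => [|_ [x _ <-]]; last exact: sub_slatP.
  exact: sub_countable (card_image_le _ _) cG.
have sj (G : set P) (cG : countable G) : supremums G (mk_sub h (cj G cG)).
  have [ub lub] := bigjoinP [set val x | x in G].
  split=> [x Gx|x ubx]; rewrite leEsub; first by apply: ub; exists x.
  by apply: lub => _ [y Gy <-]; have := ubx _ Gy; rewrite leEsub.
split.
- by exists (mk_sub h (ssf_bot hS)) => x; rewrite leEsub le0x.
- by exists (mk_sub h (ssf_top hS)) => x; rewrite leEsub lex1.
- by move=> x y; exists (x `&` y).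
- move=> x y; have c : countable [set x; y] by exact: finite_set_countable.
  by exists (mk_sub h (cj _ c)).
- by move=> G cG; exists (mk_sub h (cj G cG)).
- move=> a G s m cG sG /infP ->.
  have -> : [set z | exists2 y, G y & infimums [set a; y] z] =
            [set a `&` y | y in G].
    apply/seteqP; split=> [z [y Gy /infP ->]|_ [y Gy <-]]; first by exists y.
    by exists y.
  have cG' : countable [set a `&` y | y in G].
    exact: sub_countable (card_image_le _ _) cG.
  have <- : mk_sub h (cj _ cG') = a `&` s; last exact: sj.
  have <- : mk_sub h (cj _ cG) = s by exact: is_subset1_supremums (sj _ _) sG.
  apply: val_inj; rewrite /= /bj meet_bigjoin; congr bigjoin.
  apply/seteqP; split=> [_ [_ [y Gy <-] <-]|_ [_ [y Gy <-] <-]].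
    by exists (val y) => //; exists y.
  by exists (a `&` y) => //; exists y.
Qed.

Definition gen_sigma (X : set L) : set L := smallest is_sub_sigma_frame X.

Lemma gen_sigma_sub X : X `<=` gen_sigma X.
Proof. exact: sub_smallest. Qed.

Lemma gen_sigma_ssf X : is_sub_sigma_frame (gen_sigma X).
Proof.
split.
- by move=> S [hS _]; exact: ssf_bot.
- by move=> S [hS _]; exact: ssf_top.
- by move=> x y hx hy S hSX; apply: (ssf_meet hSX.1); [exact: hx|exact: hy].
- move=> G cG GS S hSX; apply: (ssf_cjoin hSX.1) => // x Gx.
  exact: (GS _ Gx).
Qed.

Definition base_slat A (hA : is_S_base A) : meetSemilatticeType d :=
  sub_slat (S_base_meet hA).

Definition L_sigma A : meetSemilatticeType d :=
  sub_slat (ssf_meet (gen_sigma_ssf A)).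

Definition base_emb A (hA : is_S_base A) : base_slat hA -> L_sigma A :=
  fun a => mk_sub _ (gen_sigma_sub (sub_slatP a)).

End Bases.

Section DIdeals.
Context d (M : meetSemilatticeType d).
Implicit Types (G E : set M) (a s : M).

Definition admissible G : Prop :=
  exists2 s, supremums G s &
    forall a, supremums [set a `&` y | y in G] (a `&` s).

Record is_D_ideal E : Prop := {
  D_ideal_down : forall x y, x <= y -> E y -> E x;
  D_ideal_sup : forall G s, admissible G -> G `<=` E -> supremums G s -> E s
}.

Definition D_infty : Type := set_type [set E | is_D_ideal E].

HB.instance Definition _ :=
  SubChoice.copy D_infty (set_type [set E | is_D_ideal E]).
HB.instance Definition _ := [SubChoice_isSubPOrder of D_infty by <: with d].

Lemma D_inftyP (E : D_infty) : is_D_ideal (val E).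
Proof. exact: (set_valP E). Qed.

Definition mk_D_infty E (hE : is_D_ideal E) : D_infty := exist _ E (mem_set hE).

Lemma D_infty_leP (E F : D_infty) : reflect (val E `<=` val F) (E <= F).
Proof. by rewrite leEsub; apply: (iffP idP); rewrite subsetEset. Qed.

Fact D_ideal_setI E F :
  is_D_ideal E -> is_D_ideal F -> is_D_ideal (E `&` F)%classic.
Proof.
move=> hE hF; split=> [x y xy [Ey Fy]|G s aG GEF sG].
  by split; [exact: D_ideal_down xy Ey|exact: D_ideal_down xy Fy].
split; [apply: (D_ideal_sup hE aG) sG|apply: (D_ideal_sup hF aG) sG].
- by move=> x /GEF[].
- by move=> x /GEF[].
Qed.

Fact D_ideal_setT : is_D_ideal [set: M].
Proof. by []. Qed.

Fact D_ideal_smallest (X : set M) : is_D_ideal (smallest is_D_ideal X).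
Proof.
split=> [x y xy hy E hE|G s aG GE sG E hE].
  by apply: (D_ideal_down hE.1 xy); exact: hy.
apply: (D_ideal_sup hE.1 aG) sG => x Gx.
exact: (GE _ Gx).
Qed.

Definition D_meet (E F : D_infty) : D_infty :=
  mk_D_infty (D_ideal_setI (D_inftyP E) (D_inftyP F)).
Definition D_top : D_infty := mk_D_infty D_ideal_setT.
Definition D_bigjoin (S : set D_infty) : D_infty :=
  mk_D_infty (D_ideal_smallest [set x | exists2 E, S E & val E x]).

Fact D_bigjoinP S : supremums S (D_bigjoin S).
Proof.
split=> [E SE|F ubF]; apply/D_infty_leP.
  by move=> x Ex C [_]; apply; exists E.
apply: smallest_sub => [|x [E SE Ex]]; first exact: D_inftyP.
by move/D_infty_leP: (ubF _ SE); exact.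
Qed.

Definition D_join (E F : D_infty) : D_infty := D_bigjoin [set E; F].
Definition D_bot : D_infty := D_bigjoin set0.

Fact D_lexI (E F H : D_infty) : (E <= D_meet F H) = (E <= F) && (E <= H).
Proof.
apply/D_infty_leP/andP => [EFH|[/D_infty_leP EF /D_infty_leP EH]].
  by split; apply/D_infty_leP => x /EFH[].
by move=> x Ex; split; [exact: EF|exact: EH].
Qed.

Fact D_leUx (E F H : D_infty) : (D_join E F <= H) = (E <= H) && (F <= H).
Proof.
have [ub lub] := D_bigjoinP [set E; F].
apply/idP/andP => [le|[EH FH]].
  by split; apply: le_trans le; apply: ub; [left|right].
by apply: lub => _ [->|->].
Qed.

HB.instance Definition _ :=
  Order.POrder_isMeetSemilattice.Build d D_infty D_lexI.
HB.instance Definition _ :=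
  Order.POrder_isJoinSemilattice.Build d D_infty D_leUx.

Fact D_le0x (E : D_infty) : D_bot <= E.
Proof. by apply: (D_bigjoinP set0).2. Qed.

Fact D_lex1 (E : D_infty) : E <= D_top.
Proof. exact/D_infty_leP. Qed.

HB.instance Definition _ := Order.hasBottom.Build d D_infty D_le0x.
HB.instance Definition _ := Order.hasTop.Build d D_infty D_lex1.

Fact D_ideal_imp E F : is_D_ideal E -> is_D_ideal F ->
  is_D_ideal [set x | forall e, E e -> F (e `&` x)].
Proof.
move=> hE hF; split=> [x y xy hy e Ee|G s [t tG dG] Gimp sG e Ee].
  by apply: (D_ideal_down hF _ (hy e Ee)); exact: leI2.
have <- : t = s by exact: is_subset1_supremums tG sG.
apply: (D_ideal_sup hF) (dG e) => [|_ [y Gy <-]]; last exact: Gimp.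
exists (e `&` t) => // a.
have -> : [set a `&` z | z in [set e `&` y | y in G]] =
          [set (a `&` e) `&` y | y in G].
  apply/seteqP; split=> [_ [_ [y Gy <-] <-]|_ [y Gy <-]].
    by exists y; rewrite ?meetA.
  by exists (e `&` y); [exists y|rewrite meetA].
by rewrite meetA.
Qed.

Fact D_meet_bigjoin (E : D_infty) (S : set D_infty) :
  E `&` D_bigjoin S = D_bigjoin [set E `&` F | F in S].
Proof.
apply/eqP; rewrite eq_le; apply/andP; split; last first.
  apply: (D_bigjoinP _).2 => _ [F SF <-]; apply: leI2 => //.
  exact: (D_bigjoinP S).1.
set J := D_bigjoin [set _ | _ in _].
have hI := D_ideal_imp (D_inftyP E) (D_inftyP J).
apply/D_infty_leP => x [Ex Sx].
suff sub : val (D_bigjoin S) `<=` val (mk_D_infty hI).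
  by have := sub x Sx x Ex; rewrite meetxx.
apply/D_infty_leP; apply: (D_bigjoinP S).2 => F SF; apply/D_infty_leP.
move=> y Fy e Ee.
have /D_infty_leP : E `&` F <= J by apply: (D_bigjoinP _).1; exists F.
apply; split.
  by apply: (D_ideal_down (D_inftyP E) _ Ee); exact: leIl.
by apply: (D_ideal_down (D_inftyP F) _ Fy); exact: leIr.
Qed.

HB.instance Definition _ :=
  TBLattice_isFrame.Build d D_infty D_bigjoinP D_meet_bigjoin.

Fact D_ideal_principal a : is_D_ideal [set x | x <= a].
Proof.
split=> [x y|G s _ Ga [_]]; first exact: le_trans.
by apply => x; exact: Ga.
Qed.

Definition principal a : D_infty := mk_D_infty (D_ideal_principal a).

Definition D_sigma : set D_infty := gen_sigma (range principal).

End DIdeals.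

Arguments base_emb {d L A} hA _.
Arguments D_infty {d} M.
Arguments principal {d} M a.
Arguments D_sigma {d} M _.

(* Main.v *)
Require Import Defs.
From mathcomp Require Import all_boot all_order.
From mathcomp Require Import boolp classical_sets cardinality.

(** The theorem says that a base [A] which is a sigma-frame in its own order is
    the same thing as a quotient of the sigma-frame [L_sigma A] that it
    generates.

    The bridge is the hull map [D_hull] from [L] to the frame of D-ideals of
    [A]: it sends [x] to the D-ideal generated by the elements of [A] below
    [x].  A join of elements of [A] computed in [L] that happens to lie in [A]
    is an admissible join of [A], because binary meets distribute over it in
    [L] ([admissible_bigjoin]).  D-ideals are closed under such joins, so the
    hull map preserves all joins ([D_hull_bigjoin]); it preserves finite meets
    because D-ideals form a frame.  It extends the embedding of [A] by
    principal ideals, hence maps [L_sigma A] into the sub-sigma-frame generated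
    by the principal ideals ([D_hull_sigma]).

    If the principal ideals already form that sub-sigma-frame, then the hull of
    each [x] in [L_sigma A] is the principal ideal of some [r x].  As [x <= a]
    if and only if the hull of [x] lies in the principal ideal of [a], this [r]
    is left adjoint to the inclusion, and it preserves meets since the hull
    does.  Composing such an adjoint with the inclusion gives a nucleus with
    fixpoints [A], and the fixpoints of a nucleus on a sigma-frame form a
    sigma-frame with joins [nu (\bigvee G)] ([sigma_frame_fix]).  Finally, if
    [A] is a sigma-frame, its countable subsets are admissible, so the countable
    joins of principal ideals are principal and the principal ideals are the
    whole of the sub-sigma-frame that they generate. *)

Set Implicit Arguments.
Unset Strict Implicit.
Unset Printing Implicit Defensive.
Import Order.TTheory.
Local Open Scope classical_set_scope.
Local Open Scope order_scope.

(** * Meets, countable images and frame joins *)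

Lemma infimums_set2P d (M : meetSemilatticeType d) (x y m : M) :
  infimums [set x; y] m <-> m = x `&` y.
Proof.
split=> [[lb gl]|->].
  apply: le_anti; rewrite lexI (lb x) ?(lb y); [|by right|by left].
  by apply: gl => _ [->|->]; [exact: leIl|exact: leIr].
split=> [_ [->|->]|z lb]; [exact: leIl|exact: leIr|].
by rewrite lexI !lb //; [right|left].
Qed.

Lemma meets_set2E d (M : meetSemilatticeType d) (a : M) (G : set M) :
  [set z | exists2 y, G y & infimums [set a; y] z] = [set a `&` y | y in G].
Proof.
apply/seteqP; split=> [z [y Gy /infimums_set2P ->]|_ [y Gy <-]].
  by exists y.
by exists y => //; apply/infimums_set2P.
Qed.

Lemma countable_image T U (f : T -> U) (G : set T) :
  countable G -> countable (f @` G).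
Proof. exact: sub_countable (card_image_le _ _). Qed.

Section FrameJoins.
Context d (L : frameType d).
Implicit Types (S : set L) (x y : L).

Lemma bigjoin_ub S x : S x -> x <= bigjoin S.
Proof. exact: (bigjoinP S).1. Qed.

Lemma bigjoin_lub S y : (forall x, S x -> x <= y) -> bigjoin S <= y.
Proof. exact: (bigjoinP S).2. Qed.

End FrameJoins.

(** * Sigma-frames of fixpoints *)

Section Fixpoints.
Context d d' (P : meetSemilatticeType d) (Q : meetSemilatticeType d').
Context (e : P -> Q) (nu : Q -> Q).
Hypotheses (e_mono : {mono e : x y / x <= y}) (e_meet : left_exact e).
Hypotheses (nu_nucleus : is_nucleus nu) (e_fix : range e = fix_set nu).

Lemma nucleus_homo : {homo nu : x y / x <= y}.
Proof.
move=> x y /meet_idPl xy; apply/meet_idPl.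
by rewrite -(nucleus_meet nu_nucleus) xy.
Qed.

Lemma nucleus_embK x : nu (e x) = e x.
Proof.
have : range e (e x) by exists x.
by rewrite e_fix.
Qed.

Lemma nucleus_emb_preim q : exists x, e x = nu q.
Proof.
have [x _ ex] : range e (nu q).
  by rewrite e_fix /fix_set /=; exact: nucleus_idem.
by exists x.
Qed.

(** A fixpoint lies above [q] exactly when it lies above [nu q], so the join of
    fixpoints is the closure of their join in [Q]; this serves for existence
    of joins and for distributivity alike. *)
Lemma supremums_fix (G : set P) (q : Q) (s : P) :
  supremums (e @` G) q -> e s = nu q -> supremums G s.
Proof.
move=> [ub lub] es; split=> [y Gy|u ubu]; rewrite -e_mono es.
  by apply: le_trans (nucleus_le nu_nucleus q); apply: ub; exists y.
rewrite -(nucleus_embK u); apply: nucleus_homo; apply: lub => _ [y Gy <-].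
by rewrite e_mono; exact: ubu.
Qed.

(** The fixpoints inherit distributivity because the nucleus preserves
    meets: [a `&` nu q = nu (a `&` q)] for a fixpoint [a]. *)
Lemma sigma_frame_fix : is_sigma_frame Q -> is_sigma_frame P.
Proof.
move=> sQ.
have cjoin (G : set P) : countable G -> exists s, supremums G s.
  move=> /(countable_image e)/(sframe_cjoin sQ)[q sq].
  by have [s es] := nucleus_emb_preim q; exists s; exact: supremums_fix es.
split=> //.
- have [b b_le] := sframe_bot sQ; have [x ex] := nucleus_emb_preim b.
  exists x => y; rewrite -e_mono ex -(nucleus_embK y).
  exact: nucleus_homo.
- have [t le_t] := sframe_top sQ; have [x ex] := nucleus_emb_preim t.
  exists x => y; rewrite -e_mono ex -(nucleus_embK y).
  exact: nucleus_homo.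
- by move=> x y; exists (x `&` y); apply/infimums_set2P.
- by move=> x y; apply: cjoin; exact: finite_set_countable.
move=> a G s m cG sG /infimums_set2P ->; rewrite meets_set2E.
have ceG := countable_image e cG; have [q sq] := sframe_cjoin sQ ceG.
have es : e s = nu q.
  have [s' es'] := nucleus_emb_preim q.
  by rewrite (is_subset1_supremums sG (supremums_fix sq es')).
have infq : infimums [set e a; q] (e a `&` q) by apply/infimums_set2P.
have := sframe_distr sQ ceG sq infq; rewrite meets_set2E => sup_meets.
apply: (supremums_fix (q := e a `&` q)); last first.
  by rewrite e_meet es (nucleus_meet nu_nucleus) nucleus_embK.
rewrite image_comp in sup_meets; rewrite image_comp.
by congr (supremums _ _): sup_meets; apply: eq_imagel => y _; rewrite /= e_meet.
Qed.

End Fixpoints.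

(** An order embedding makes the counit of the adjunction an identity,
    [r (e x) = x], which gives both idempotence and the fixpoints. *)
Lemma nucleus_of_left_adjoint d d' (P : meetSemilatticeType d)
    (Q : meetSemilatticeType d') (e : P -> Q) (r : Q -> P) :
    {mono e : x y / x <= y} -> left_exact e ->
    left_adjoint r e -> left_exact r ->
  is_nucleus (e \o r) /\ range e = fix_set (e \o r).
Proof.
move=> e_mono e_meet adj r_meet.
have reK x : r (e x) = x.
  by apply: le_anti; rewrite adj lexx -e_mono -adj lexx.
split; first split=> [x|x|x y] /=; rewrite ?reK -?adj ?r_meet ?e_meet //.
apply/seteqP; split=> [_ [x _ <-]|q /= <-]; last by exists (r q).
by rewrite /fix_set /= reK.
Qed.

(** * Principal ideals *)

Section Principal.
Context d (M : meetSemilatticeType d).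
Implicit Types (a b : M) (G : set M) (E : D_infty M).

Lemma principal_leP a E : reflect (val E a) (principal M a <= E).
Proof.
apply: (iffP (D_infty_leP _ _)) => [aE|Ea x xa]; first by apply: aE => /=.
exact: (D_ideal_down (D_inftyP E) xa Ea).
Qed.

Lemma principal_mono : {mono principal M : a b / a <= b}.
Proof. by move=> a b; apply/principal_leP/idP. Qed.

Lemma principalI : {morph principal M : a b / a `&` b}.
Proof.
move=> a b; apply: val_inj; apply/seteqP; split=> x /=.
  by rewrite lexI => /andP.
by rewrite lexI => -[-> ->].
Qed.

(** D-ideals are closed under admissible joins, so the principal ideal of such
    a join is the join of the principal ideals. *)
Lemma bigjoin_principal G s : admissible G -> supremums G s ->
  bigjoin (principal M @` G) = principal M s.
Proof.
move=> adG sG; apply: le_anti; apply/andP; split.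
  apply: bigjoin_lub => _ [a Ga <-]; rewrite principal_mono.
  exact: sG.1.
apply/principal_leP.
apply: (D_ideal_sup (D_inftyP _) adG _ sG) => a Ga.
by apply/principal_leP; apply: bigjoin_ub; exists a.
Qed.

Lemma countable_admissible G :
  is_sigma_frame M -> countable G -> admissible G.
Proof.
move=> sM cG; have [s sG] := sframe_cjoin sM cG; exists s => // a.
rewrite -meets_set2E; apply: (sframe_distr sM cG sG).
exact/infimums_set2P.
Qed.

(** In a sigma-frame countable distributivity says that countable subsets are
    admissible, and admissible joins are the ones that principal ideals
    respect. *)
Lemma range_principal_sub_sigma_frame :
  is_sigma_frame M -> is_sub_sigma_frame (range (principal M)).
Proof.
move=> sM.
have cjoin G : countable G -> range (principal M) (bigjoin (principal M @` G)).
  move=> cG; have [s sG] := sframe_cjoin sM cG; exists s => //.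
  by rewrite (bigjoin_principal _ sG) //; exact: countable_admissible.
split.
  (* The least D-ideal is not empty: it contains the join of the empty set,
     which is admissible. *)
- have -> : \bot = bigjoin (principal M @` set0).
    by apply: le_anti; rewrite le0x image_set0 bigjoin_lub.
  exact: cjoin.
- have [t le_t] := sframe_top sM; exists t => //.
  by apply: val_inj; apply/seteqP; split=> // x _; exact: le_t.
- by move=> _ _ [a _ <-] [b _ <-]; exists (a `&` b); rewrite ?principalI.
- move=> F cF Fp; have FE : F = principal M @` (principal M @^-1` F).
    apply/seteqP; split=> [E FE|_ [a Fa <-] //].
    by have [a _ aE] := Fp E FE; exists a; rewrite /preimage /= ?aE.
  have inj := inc_inj principal_mono.
  rewrite FE; apply: cjoin; move: cF; rewrite {1}FE.
  by rewrite (eq_countable (inj_card_eq (in2W inj))).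
Qed.

End Principal.

Lemma gen_sigma_id d (L : frameType d) (S : set L) :
  is_sub_sigma_frame S -> gen_sigma S = S.
Proof.
move=> hS; apply/seteqP; split; last exact: gen_sigma_sub.
exact: smallest_sub.
Qed.

(** * The hull map *)

Section Hull.
Context d (L : frameType d) (A : set L) (hA : is_S_base A).
Local Notation M := (base_slat hA).
Local Notation bval := (fun a : M => val a : L).
Implicit Types (x y : L) (a b : M) (G : set M) (S : set L).

Lemma base_dense x y : (forall a, bval a <= x -> bval a <= y) -> x <= y.
Proof.
have [G GA ->] := S_base_base hA x => xy; apply: bigjoin_lub => g Gg.
by apply: (xy (mk_sub _ (GA g Gg))); exact: bigjoin_ub.
Qed.

(** The converse fails: a join in the order of the base may lie strictly above
    the join in [L]. *)
Lemma supremums_base G a :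
  bval a = bigjoin (bval @` G) -> supremums G a.
Proof.
move=> aG; split=> [b Gb|b ubb]; rewrite -Order.le_val -/(bval a) aG.
  by apply: bigjoin_ub; exists b.
by apply: bigjoin_lub => _ [c Gc <-]; have := ubb _ Gc; rewrite -Order.le_val.
Qed.

(** The meets required by admissibility come from distributivity in [L], where
    the join of [G] is computed. *)
Lemma admissible_bigjoin G a :
  bval a = bigjoin (bval @` G) -> admissible G.
Proof.
move=> aG; exists a => [|b]; first exact: supremums_base.
apply: supremums_base; rewrite [LHS]/= -/(bval a) aG meet_bigjoin.
by rewrite !image_comp.
Qed.

(** The D-ideal generated by the elements of the base below [x], written as a
    join so that the frame laws of D-ideals apply to it. *)
Definition D_hull x : D_infty M :=
  bigjoin (principal M @` [set a | bval a <= x]).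

Lemma D_hull_le : {homo D_hull : x y / x <= y}.
Proof.
move=> x y xy; apply: bigjoin_lub => _ [a /= ax <-].
by apply: bigjoin_ub; exists a => //=; exact: le_trans xy.
Qed.

Lemma D_hull_principal a : D_hull (bval a) = principal M a.
Proof.
apply: le_anti; apply/andP; split; last by apply: bigjoin_ub; exists a => /=.
by apply: bigjoin_lub => _ [b /= ba <-]; rewrite principal_mono -Order.le_val.
Qed.

(** Elements of the base are recovered from their principal ideals, and density
    of the base reduces comparison with [x] to the elements below it. *)
Lemma D_hull_adj x a : (D_hull x <= principal M a) = (x <= bval a).
Proof.
apply/idP/idP => [xa|/D_hull_le]; last by rewrite D_hull_principal.
apply: base_dense => b bx; rewrite Order.le_val -principal_mono.
by apply: le_trans xa; apply: bigjoin_ub; exists b.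
Qed.

(** An element [a] of the base below the join of [S] is the join, in [L], of
    its meets with the elements of the base below members of [S].  This join is
    admissible, so any D-ideal containing those elements contains [a]. *)
Lemma D_hull_bigjoin S : D_hull (bigjoin S) = bigjoin (D_hull @` S).
Proof.
apply: le_anti; apply/andP; split; last first.
  by apply: bigjoin_lub => _ [x Sx <-]; apply: D_hull_le; exact: bigjoin_ub.
apply: bigjoin_lub => _ [a /= aS <-]; apply/principal_leP.
pose B := [set b | exists2 x, S x & bval b <= x].
have aB : bval a = bigjoin (bval @` [set a `&` b | b in B]).
  have -> : bval @` [set a `&` b | b in B] = [set bval a `&` x | x in bval @` B].
    by rewrite !image_comp.
  rewrite -meet_bigjoin; apply/esym/meet_idPl/(le_trans aS).
  apply: bigjoin_lub => x Sx; apply: base_dense => b bx.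
  by apply: bigjoin_ub; exists b => //; exists x.
apply: (D_ideal_sup (D_inftyP _) (admissible_bigjoin aB) _ (supremums_base aB)).
move=> _ [b [x Sx bx] <-]; apply/principal_leP.
have bS : principal M b <= bigjoin (D_hull @` S).
  apply: (@le_trans _ _ (D_hull x)); last by apply: bigjoin_ub; exists x.
  by apply: bigjoin_ub; exists b.
by apply: le_trans bS; rewrite principal_mono leIr.
Qed.

Lemma D_hull1 : D_hull \top = \top.
Proof.
apply: le_anti; rewrite lex1 /=; apply/D_infty_leP => a _; apply/principal_leP.
by apply: bigjoin_ub; exists a => //=; exact: lex1.
Qed.

Lemma D_hullI : {morph D_hull : x y / x `&` y}.
Proof.
move=> x y; apply: le_anti; apply/andP; split.
  by rewrite lexI !D_hull_le ?leIl ?leIr.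
rewrite /(D_hull y) meet_bigjoin; apply: bigjoin_lub => _ [_ [b /= yb <-] <-].
rewrite meetC meet_bigjoin; apply: bigjoin_lub => _ [_ [a /= xa <-] <-].
rewrite -principalI; apply: bigjoin_ub; exists (b `&` a) => //=.
by rewrite meetC leI2.
Qed.

(** The hull is a frame morphism extending [principal], so the elements that it
    sends into [D_sigma] form a sub-sigma-frame containing the base. *)
Lemma D_hull_sigma x : gen_sigma A x -> D_sigma M (D_hull x).
Proof.
have sD := gen_sigma_ssf (range (principal M)).
apply: (@smallest_sub _ _ _ (D_hull @^-1` D_sigma M)) => [|a Aa]; last first.
  rewrite /preimage /= (D_hull_principal (mk_sub _ Aa)).
  by apply: gen_sigma_sub; exists (mk_sub _ Aa).
split; rewrite /preimage /=.
- have -> : \bot = bigjoin set0 :> L.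
    by apply: le_anti; rewrite le0x bigjoin_lub.
  by rewrite D_hull_bigjoin image_set0; apply: (ssf_cjoin sD).
- by rewrite D_hull1; exact: ssf_top sD.
- by move=> y z Dy Dz /=; rewrite D_hullI; exact: (ssf_meet sD).
- move=> G cG GD; rewrite D_hull_bigjoin; apply: (ssf_cjoin sD).
    exact: countable_image.
  by move=> _ [y Gy <-]; exact: GD.
Qed.

Lemma left_exact_adjoint_of_D_sigma : range (principal M) = D_sigma M ->
  exists r : L_sigma A -> M, left_adjoint r (base_emb hA) /\ left_exact r.
Proof.
move=> pD.
have ex (x : L_sigma A) : {a | principal M a = D_hull (val x)}.
  apply: cid; have := D_hull_sigma (sub_slatP x).
  by rewrite -pD => -[a _ ax]; exists a.
exists (fun x : L_sigma A => projT1 (ex x)); split=> [x a|x y].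
  by rewrite -principal_mono (projT2 (ex x)) D_hull_adj -Order.le_val.
apply: (inc_inj (@principal_mono _ M)).
by rewrite principalI !(projT2 (ex _)) -D_hullI.
Qed.

Lemma base_emb_mono : {mono base_emb hA : a b / a <= b}.
Proof. by move=> a b; rewrite -Order.le_val. Qed.

Lemma base_embI : left_exact (base_emb hA).
Proof. by move=> a b; apply: val_inj. Qed.

End Hull.

Theorem theorem4p8 (d : Order.disp_t) (L : frameType d) (A : set L)
    (hA : is_Sstar_base A) :
  [<-> (* (1) *) is_sigma_frame (base_slat hA);
       (* (2) *) range (principal (base_slat hA)) = D_sigma (base_slat hA);
       (* (3) *) exists r : L_sigma A -> base_slat hA,
                   left_adjoint r (base_emb hA) /\ left_exact r;
       (* (4) *) exists2 nu : L_sigma A -> L_sigma A,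
                   is_nucleus nu & range (base_emb hA) = fix_set nu].
Proof.
tfae.
- by move=> /range_principal_sub_sigma_frame/gen_sigma_id/esym.
- exact: left_exact_adjoint_of_D_sigma.
- move=> [r [adj r_meet]].
  have [nuP fixE] := nucleus_of_left_adjoint (@base_emb_mono _ _ _ hA)
    (@base_embI _ _ _ hA) adj r_meet.
  by exists (base_emb hA \o r).
- move=> [nu nuP fixE].
  apply: (sigma_frame_fix (@base_emb_mono _ _ _ hA) (@base_embI _ _ _ hA)
    nuP fixE).
  exact: sub_sigma_frameP.
Qed.
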